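(* Let $\Phi:\mathbb{R}^n\to(-\infty,\infty]$ be a proper lower semicontinuous convex function. Then there exists a lower semicontinuous convex function $\varphi:[0,\infty)\times\mathbb{R}^n\to(-\infty,\infty]$, $\varphi=\varphi(x,y)$, such that (i) $\varphi(0,y)=\Phi(y)$ for all $y\in\mathbb{R}^n$; (ii) $\lim_{x\to0+}\varphi(x,y)=\Phi(y)$ for each $y\in\mathbb{R}^n$; (iii) $\varphi$ is real-valued and $C^\infty$ on $(0,\infty)\times\mathbb{R}^n$. Moreover: if $\Phi\ge 0$ then $\varphi$ can be chosen so that in addition $\varphi\ge0$; if $\Phi:\mathbb{R}^n\to(-\infty,\infty]$ is continuous (as a map into the extended reals), then $\varphi$ can be chosen so that in addition $\varphi:[0,\infty)\times\mathbb{R}^n\to(-\infty,\infty]$ is continuous; and if $\Phi$ is strictly convex on $\operatorname{dom}\Phi$, then $\varphi$ can be chosen so that in addition $\varphi$ is strictly convex on $(0,\infty)\times\mathbb{R}^n$.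
   Context: A convex function $\Phi:\mathbb{R}^n\to(-\infty,\infty]$ is proper if it is not identically $+\infty$. $\operatorname{dom}\Phi:=\{y\in\mathbb{R}^n:\Phi(y)<\infty\}$. Continuity into $(-\infty,\infty]$ is with respect to the usual topology of the extended real line. *)

(* Defs.v *)
From HB Require Import structures.
From mathcomp Require Import all_boot all_order all_algebra.
From mathcomp Require Import all_classical all_reals all_analysis.
Set Implicit Arguments. Unset Strict Implicit. Unset Printing Implicit Defensive.
Import Order.TTheory GRing.Theory Num.Theory.
Import numFieldNormedType.Exports.
Local Open Scope classical_set_scope.
Local Open Scope ring_scope.

Fixpoint iter_dderiv {R : realType} {E : normedModType R}
    (vs : seq E) (f : E -> R) : E -> R :=
  match vs with
  | [::] => f
  | v :: vs' => fun p => 'D_v (iter_dderiv vs' f) p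
  end.

Definition smooth_on {R : realType} {E : normedModType R}
    (U : set E) (f : E -> R) : Prop :=
  forall (vs : seq E) (p : E), U p ->
    {for p, continuous (iter_dderiv vs f)} /\
    (forall v : E, derivable (iter_dderiv vs f) p v).

Local Open Scope ereal_scope.

Definition econvex_on {R : realType} {E : lmodType R}
    (A : set E) (f : E -> \bar R) : Prop :=
  forall (p q : E) (t : R), A p -> A q -> (0 < t < 1)%R ->
    f (t *: p + (1 - t) *: q)%R <= t%:E * f p + (1 - t)%:E * f q.

Definition strictly_econvex_on {R : realType} {E : lmodType R}
    (A : set E) (f : E -> \bar R) : Prop :=
  forall (p q : E) (t : R), A p -> A q -> p != q -> (0 < t < 1)%R ->
    f (t *: p + (1 - t) *: q)%R < t%:E * f p + (1 - t)%:E * f q.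

Definition lsc_within {T : topologicalType} {R : realType}
    (A : set T) (f : T -> \bar R) : Prop :=
  forall x, A x -> forall a : R, a%:E < f x ->
    \forall y \near x, A y -> a%:E < f y.

Definition edom {T : Type} {R : realType} (f : T -> \bar R) : set T :=
  [set y | f y < +oo].

Definition proper_fun {T : Type} {R : realType} (f : T -> \bar R) : Prop :=
  (forall y, f y != -oo) /\ (exists y, f y != +oo).

Definition closed_half (R : realType) (n : nat) : set (R * 'rV[R]_n) :=
  [set p | (0 <= p.1)%R].
Definition open_half (R : realType) (n : nat) : set (R * 'rV[R]_n) :=
  [set p | (0 < p.1)%R].

(* phi : [0,oo) x R^n -> (-oo,+oo] (values for x < 0 are irrelevant) is
   lsc and convex and satisfies (i), (ii), (iii) of the theorem w.r.t. Phi *)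
Definition good_extension (R : realType) (n : nat)
    (Phi : 'rV[R]_n -> \bar R) (phi : R * 'rV[R]_n -> \bar R) : Prop :=
  (forall p, @closed_half R n p -> phi p != -oo) /\
  [/\  lsc_within (@closed_half R n) phi,
      econvex_on (@closed_half R n) phi,
      (forall y, phi (0%R, y) = Phi y),
      (forall y, phi (x, y) @[x --> 0^'+] --> Phi y)
    & (forall p, @open_half R n p -> phi p \is a fin_num) /\
      smooth_on (@open_half R n) (fun p => fine (phi p))].

(* Main.v *)
(* A proper lsc convex function is a countable supremum of affine functions
   l_k(y) = b_k + a_k y: affine minorants come from projecting points onto the
   closed convex epigraph, and a dense sequence of minorants suffices.  With
   weights w_k > 0 decreasing fast enough in k and |(b_k, a_k)|, put
     phi(x, y) = x ln (sum_k w_k exp (l_k(y) / x)) + x^2   for x > 0,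
     phi(0, y) = Phi(y).
   The series in (1/x, y/x) converges with all its derivatives, so phi is smooth.
   The first summand is at most s iff sum_k w_k exp ((l_k(y) - s) / x) <= 1, from
   which joint convexity follows by convexity of exp.  As x -> 0+, phi tends to
   sup_k l_k, with the two-sided bound
     l_k(y) + x ln w_k + x^2 <= phi(x, y) <= Phi(y) + x ln (sum_k w_k) + x^2,
   which also gives lower semicontinuity, continuity, and (if l_0 = 0, w_0 = 1)
   nonnegativity.  Strictness comes from x^2 when the x-coordinates differ, and
   otherwise from an index k at which two exponents differ. *)
Require Import Defs.
From HB Require Import structures.
From mathcomp Require Import all_boot all_order all_algebra.
From mathcomp Require Import all_classical all_reals all_analysis.
From mathcomp Require Import ring lra.
Import Order.TTheory GRing.Theory Num.Theory.
Import numFieldNormedType.Exports.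
Local Open Scope classical_set_scope.
Local Open Scope ring_scope.

Set Implicit Arguments.
Unset Strict Implicit.

(** * Sums of rapidly decreasing exponential series *)

Section tsum.
Context {R : realType}.
Implicit Types f g : nat -> R.

Definition tsum f : R := limn (series f).

(** Absolute summability in a form that passes through sums, multiples and comparisons by pointwise
    estimates alone. *)
Definition geo_dominated f := exists C : R, forall k, `|f k| <= C * 2^-1 ^+ k.

Lemma geo_dominated_cvg f : geo_dominated f -> cvgn (series f).
Proof.
move=> [C fC]; apply: normed_cvg.
apply: (@series_le_cvg R (fun k => `|f k|) (geometric C 2^-1)) => //.
  by move=> k; exact: le_trans (fC k).
apply: is_cvg_geometric_series.
by rewrite ger0_norm ?invr_ge0// invf_lt1 ?ltr1n.
Qed.

Lemma geo_dominated_le f g : (forall k, `|f k| <= `|g k|) ->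
  geo_dominated g -> geo_dominated f.
Proof. by move=> fg [C gC]; exists C => k; exact: le_trans (gC k). Qed.

Lemma geo_dominatedZ c f :
  geo_dominated f -> geo_dominated (fun k => c * f k).
Proof.
move=> [C fC]; exists (`|c| * C) => k.
by rewrite normrM -mulrA ler_wpM2l.
Qed.

Lemma geo_dominatedD f g : geo_dominated f -> geo_dominated g ->
  geo_dominated (fun k => f k + g k).
Proof.
move=> [C fC] [D gD]; exists (C + D) => k.
by rewrite mulrDl (le_trans (ler_normD _ _))// lerD.
Qed.

Lemma geo_dominated_norm f :
  geo_dominated f -> geo_dominated (fun k => `|f k|).
Proof. by apply: geo_dominated_le => k; rewrite normr_id. Qed.

Lemma tsumD f g : geo_dominated f -> geo_dominated g ->
  tsum (fun k => f k + g k) = tsum f + tsum g.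
Proof.
by move=> /geo_dominated_cvg cf /geo_dominated_cvg cg; exact: lim_seriesD.
Qed.

Lemma tsumZ c f : geo_dominated f -> tsum (fun k => c * f k) = c * tsum f.
Proof. by move=> /geo_dominated_cvg cf; exact: (@lim_seriesZ R f c). Qed.

Lemma tsum0 : tsum (fun=> 0) = 0.
Proof.
rewrite /tsum (_ : series _ = cst 0) ?lim_cst//.
by apply/funext => n; rewrite /series /= big1.
Qed.

Lemma ler_tsum f g : geo_dominated f -> geo_dominated g ->
  (forall k, f k <= g k) -> tsum f <= tsum g.
Proof.
by move=> /geo_dominated_cvg cf /geo_dominated_cvg cg; exact: lim_series_le.
Qed.

Lemma ler_norm_tsum f g : geo_dominated g ->
  (forall k, `|f k| <= g k) -> `|tsum f| <= tsum g.
Proof.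
move=> gg fg.
have gf : geo_dominated f.
  by apply: geo_dominated_le gg => k; rewrite (le_trans (fg k)) ?ler_norm.
apply: le_trans (lim_series_norm _) _.
  exact/geo_dominated_cvg/geo_dominated_norm.
by apply: ler_tsum => //; exact: geo_dominated_norm.
Qed.

Lemma ler_term_tsum f j : geo_dominated f -> (forall k, 0 <= f k) ->
  f j <= tsum f.
Proof.
move=> gf f0; apply: le_trans (_ : series f j.+1 <= _).
  by rewrite /series /= big_nat_recr//= lerDr sumr_ge0.
apply: nondecreasing_cvgn_le; last exact: geo_dominated_cvg.
exact: nondecreasing_series.
Qed.

(** The difference series has nonnegative terms, so its sum is at least its positive term of index
    [j]. *)
Lemma ltr_tsum f g j : geo_dominated f -> geo_dominated g ->
  (forall k, f k <= g k) -> f j < g j -> tsum f < tsum g.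
Proof.
move=> gf gg fg fgj.
have gfg : geo_dominated (fun k => g k + -1 * f k).
  by apply: geo_dominatedD => //; exact: geo_dominatedZ.
have gfg0 k : 0 <= g k + -1 * f k by rewrite mulN1r subr_ge0.
have := ler_term_tsum j gfg gfg0.
rewrite tsumD ?tsumZ//; last exact: geo_dominatedZ.
by rewrite !mulN1r -(subr_gt0 (tsum f)); apply: lt_le_trans; rewrite subr_gt0.
Qed.

Lemma tsum_sum (I : Type) (s : seq I) (F : I -> nat -> R) :
  (forall i, geo_dominated (F i)) ->
  geo_dominated (fun k => \sum_(i <- s) F i k) /\
  tsum (fun k => \sum_(i <- s) F i k) = \sum_(i <- s) tsum (F i).
Proof.
move=> gF; elim: s => [|i s [gs IH]].
  rewrite big_nil -[RHS]tsum0; split.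
    by exists 0 => k; rewrite big_nil normr0 mul0r.
  by congr tsum; apply/funext => k; rewrite big_nil.
have -> : (fun k => \sum_(j <- i :: s) F j k) =
          (fun k => F i k + \sum_(j <- s) F j k).
  by apply/funext => k; rewrite big_cons.
by rewrite big_cons tsumD// IH; split => //; exact: geo_dominatedD.
Qed.

End tsum.

(** * Inner product and [l1] norm of row vectors *)

Section dot.
Context {R : realType} {n : nat}.
Implicit Types u v w : 'rV[R]_n.

Definition dot u v : R := (u *m v^T) 0 0.
Definition l1norm u : R := \sum_i `|u 0 i|.

Lemma dotE u v : dot u v = \sum_i u 0 i * v 0 i.
Proof. by rewrite /dot mxE; apply: eq_bigr => i _; rewrite mxE. Qed.

Lemma dotDr u v w : dot u (v + w) = dot u v + dot u w.
Proof. by rewrite /dot linearD/= mulmxDr mxE. Qed.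

Lemma dotDl u v w : dot (u + v) w = dot u w + dot v w.
Proof. by rewrite /dot mulmxDl mxE. Qed.

Lemma dotZr c u v : dot u (c *: v) = c * dot u v.
Proof. by rewrite /dot linearZ/= -scalemxAr mxE. Qed.

Lemma dotZl c u v : dot (c *: u) v = c * dot u v.
Proof. by rewrite /dot -scalemxAl mxE. Qed.

Lemma dotNr u v : dot u (- v) = - dot u v.
Proof. by rewrite -scaleN1r dotZr mulN1r. Qed.

Lemma dotNl u v : dot (- u) v = - dot u v.
Proof. by rewrite -scaleN1r dotZl mulN1r. Qed.

Lemma dot0l u : dot 0 u = 0.
Proof. by rewrite /dot mul0mx mxE. Qed.

Lemma dotC u v : dot u v = dot v u.
Proof. by rewrite !dotE; apply: eq_bigr => i _; rewrite mulrC. Qed.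

Lemma dot_ge0 u : 0 <= dot u u.
Proof. by rewrite dotE sumr_ge0// => i _; rewrite -expr2 sqr_ge0. Qed.

Lemma dot_eq0 u : (dot u u == 0) = (u == 0).
Proof.
apply/eqP/eqP => [|->]; last exact: dot0l.
rewrite dotE => /eqP; rewrite psumr_eq0; last first.
  by move=> i _; rewrite -expr2 sqr_ge0.
move=> /allP u0; apply/rowP => i; rewrite mxE.
by apply/eqP; have := u0 i (mem_index_enum _); rewrite /= mulf_eq0 orbb.
Qed.

Lemma l1norm_ge0 u : 0 <= l1norm u.
Proof. exact: sumr_ge0. Qed.

Lemma le_l1norm u i : `|u 0 i| <= l1norm u.
Proof. by rewrite /l1norm (bigD1 i)//= lerDl sumr_ge0. Qed.

Lemma ler_norm_dot u v : `|dot u v| <= l1norm u * l1norm v.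
Proof.
rewrite dotE (le_trans (ler_norm_sum _ _ _))// /l1norm mulr_suml.
apply: ler_sum => i _.
by rewrite normrM ler_wpM2l// le_l1norm.
Qed.

End dot.

Section expR_bounds.
Context {R : realType}.

(** Besides [1 + d <= expR d], the same inequality at [- d] gives [expR d * (1 - d) <= 1]. The
    remainder is then at most [d ^+ 2 * expR d] for [d >= 0] and at most [d ^+ 2] for [d < 0]. *)
Lemma expR_taylor1 (d : R) : `|expR d - 1 - d| <= d ^+ 2 * expR `|d|.
Proof.
have h1 := expR_ge1Dx d.
have h2 : expR d * (1 - d) <= 1.
  rewrite -[leRHS](expRxMexpNx_1 d) ler_pM2l ?expR_gt0//.
  exact: expR_ge1Dx.
have h3 := expR_gt0 d.
rewrite ger0_norm; last by lra.
have [d0|d0] := leP 0 d.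
  rewrite ger0_norm//; nra.
have h4 : 1 <= expR (- d) by rewrite -expR0 ler_expR; lra.
rewrite ltr0_norm//.
have : d ^+ 2 <= d ^+ 2 * expR (- d) by rewrite ler_peMr ?sqr_ge0.
nra.
Qed.

Lemma ler_expR_id (x : R) : x <= expR x.
Proof. by have := expR_ge1Dx x; lra. Qed.

End expR_bounds.

(** * Exponential sums over the vectors [A k] and their first-order expansion *)

Section psi.
Context {R : realType} {m : nat}.
Variable A : nat -> 'rV[R]_m.
Implicit Types (mu : nat -> R) (W D : 'rV[R]_m).

(** Decay beyond every exponential in [l1norm (A k)] makes [psi] converge everywhere and leaves room
    for the polynomial factors produced by differentiation. *)
Definition rapid mu := forall r : R,
  geo_dominated (fun k => mu k * expR (r * l1norm (A k))).

(** The Laplace transform of the signed measure with mass [mu k] at [A k]. *)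
Definition psi mu W : R := tsum (fun k => mu k * expR (dot (A k) W)).

(** The factor [A k 0 i] is absorbed by [expR (l1norm (A k))], at the price of raising [r] to
    [r + 1]. These are the coefficients of the partial derivatives of [psi]. *)
Lemma rapid_coord mu i : rapid mu -> rapid (fun k => mu k * A k 0 i).
Proof.
move=> rmu r; apply: geo_dominated_le (rmu (r + 1)) => k.
rewrite mulrDl expRD mul1r !normrM -!mulrA ler_wpM2l//.
rewrite mulrC ler_wpM2l// (le_trans (le_l1norm _ _))//.
by rewrite ger0_norm ?expR_ge0 ?ler_expR_id.
Qed.

Lemma rapid_norm mu : rapid mu -> rapid (fun k => `|mu k|).
Proof.
by move=> rmu r; apply: geo_dominated_le (rmu r) => k; rewrite !normrM normr_id.
Qed.

Lemma psi_dominated mu W : rapid mu ->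
  geo_dominated (fun k => mu k * expR (dot (A k) W)).
Proof.
move=> rmu; apply: geo_dominated_le (rmu (l1norm W)) => k.
rewrite !normrM ler_wpM2l// !ger0_norm ?expR_ge0// ler_expR mulrC.
exact: le_trans (ler_norm _) (ler_norm_dot _ _).
Qed.

(** Taylor's bound for [expR] at [dot (A k) D], summed over [k]. Continuity and differentiability of
    [psi] both rest on it. *)
Lemma psi_taylor1 mu W : rapid mu -> exists2 C : R, 0 <= C &
  forall D, l1norm D <= 1 ->
  `|psi mu (W + D) - psi mu W -
    \sum_i D 0 i * psi (fun k => mu k * A k 0 i) W| <= C * l1norm D ^+ 2.
Proof.
move=> rmu.
(* The exponent collects [l1norm W] from [expR (dot (A k) W)], [1] from the exponential in the
   Taylor remainder, where [l1norm D <= 1], and [2] from bounding [l1norm (A k) ^+ 2] by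
   [expR (2 * l1norm (A k))]. *)
pose c k := `|mu k| * expR ((l1norm W + 1 + 2) * l1norm (A k)).
have gc : geo_dominated c by exact: (rapid_norm rmu).
have c0 k : 0 <= c k by rewrite mulr_ge0 ?expR_ge0.
exists (tsum c); first exact: le_trans (ler_term_tsum 0 gc c0).
move=> D D1.
have gt i : geo_dominated
    (fun k => D 0 i * (mu k * A k 0 i * expR (dot (A k) W))).
  by apply/geo_dominatedZ/psi_dominated/rapid_coord.
have [gs ts] := tsum_sum (index_enum 'I_m) gt.
have -> : \sum_i D 0 i * psi (fun k => mu k * A k 0 i) W =
  tsum (fun k => \sum_i D 0 i * (mu k * A k 0 i * expR (dot (A k) W))).
  rewrite ts; apply: eq_bigr => i _.
  by rewrite tsumZ//; exact/psi_dominated/rapid_coord.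
rewrite -[- psi mu W]mulN1r -[X in _ + _ - X]mul1r -mulNr /psi.
have g1 := psi_dominated W rmu; have g2 := psi_dominated (W + D) rmu.
rewrite -tsumZ// -tsumZ// -!tsumD//; do ?[exact: geo_dominatedZ|
  apply: geo_dominatedD => //].
rewrite mulrC -tsumZ//.
apply: ler_norm_tsum; first exact: geo_dominatedZ.
move=> k.
have -> : \sum_i D 0 i * (mu k * A k 0 i * expR (dot (A k) W)) =
   mu k * expR (dot (A k) W) * dot (A k) D.
  by rewrite (dotE _ D) mulr_sumr; apply: eq_bigr => i _; ring.
rewrite dotDr expRD.
have -> : mu k * (expR (dot (A k) W) * expR (dot (A k) D)) +
    -1 * (mu k * expR (dot (A k) W)) +
    -1 * (mu k * expR (dot (A k) W) * dot (A k) D) =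
   mu k * (expR (dot (A k) W) * (expR (dot (A k) D) - 1 - dot (A k) D)) by ring.
rewrite !normrM /c (mulrCA (l1norm D ^+ 2)) ler_wpM2l//.
have hN := l1norm_ge0 (A k); have hD := l1norm_ge0 D.
have hAD := ler_norm_dot (A k) D.
have hADN : `|dot (A k) D| <= l1norm (A k) by rewrite (le_trans hAD)// ler_piMr.
apply: le_trans (_ : expR (l1norm (A k) * l1norm W) *
   ((l1norm (A k) * l1norm D) ^+ 2 * expR (l1norm (A k))) <= _).
  apply: ler_pM => //.
    rewrite ger0_norm ?expR_ge0// ler_expR.
    exact: le_trans (ler_norm _) (ler_norm_dot _ _).
  apply: le_trans (expR_taylor1 _) _; apply: ler_pM => //.
  - exact: sqr_ge0.
  - by rewrite -(real_normK (num_real (dot _ _))) lerXn2r ?nnegrE ?mulr_ge0.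
  - by rewrite ler_expR.
rewrite exprMn.
have -> : expR (l1norm (A k) * l1norm W) *
  (l1norm (A k) ^+ 2 * l1norm D ^+ 2 * expR (l1norm (A k))) =
  l1norm D ^+ 2 * (expR (l1norm (A k) * l1norm W) * expR (l1norm (A k)) *
    l1norm (A k) ^+ 2) by ring.
rewrite ler_wpM2l ?sqr_ge0// !mulrDl mul1r (mulrC (l1norm W)) !expRD.
rewrite ler_wpM2l ?mulr_ge0 ?expR_ge0//.
by rewrite expr2 ler_pM// ler_expR_id.
Qed.

End psi.

(** * Smoothness *)

Lemma cvg_sum_ord {R : realType} {T : Type} {F : set_system T} {FF : Filter F}
    (m : nat) (f : 'I_m -> T -> R) (l : 'I_m -> R) :
  (forall i, f i x @[x --> F] --> l i) ->
  (\sum_i f i x) @[x --> F] --> \sum_i l i.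
Proof.
move=> fl.
have -> : (fun x => \sum_i f i x) = \sum_i (f i).
  by apply/funext => x; rewrite fct_sumE.
elim/big_ind2 : _ => //=; first exact: cvg_cst.
by move=> f1 l1 f2 l2 ? ?; exact: cvgD.
Qed.

(** * Chain rule for [psi] composed with coordinate functions *)

Section psi_derive.
Context {R : realType} {m : nat} {E : normedModType R}.
Variables (A : nat -> 'rV[R]_m) (mu : nat -> R).
Hypothesis rmu : rapid A mu.
Variable r : 'I_m -> E -> R.

Let W (p : E) : 'rV[R]_m := \row_i r i p.
Let dpsi i : 'rV[R]_m -> R := psi A (fun k => mu k * A k 0 i).

Lemma cvg_l1norm_diff {T : Type} {F : set_system T} {FF : Filter F}
    (g : T -> E) (p : E) :
  (forall i, r i (g x) @[x --> F] --> r i p) ->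
  l1norm (W (g x) - W p) @[x --> F] --> 0.
Proof.
move=> rp.
have -> : 0 = \sum_(i < m) `|r i p - r i p| :> R.
  by rewrite big1// => i _; rewrite subrr normr0.
have -> : (fun x => l1norm (W (g x) - W p)) =
          (fun x => \sum_i `|r i (g x) - r i p|).
  by apply/funext => x; apply: eq_bigr => i _; rewrite !mxE.
apply: cvg_sum_ord => i; apply: cvg_norm; apply: cvgB => //; exact: cvg_cst.
Qed.

Lemma psi_remainder p : exists2 C : R, 0 <= C &
  forall q, l1norm (W q - W p) <= 1 ->
  `|psi A mu (W q) - psi A mu (W p) - \sum_i (r i q - r i p) * dpsi i (W p)|
    <= C * l1norm (W q - W p) ^+ 2.
Proof.
have [C C0 hC] := psi_taylor1 (W p) rmu; exists C => // q /hC.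
rewrite subrKC; congr (`| _ - _| <= _).
by apply: eq_bigr => i _; rewrite !mxE.
Qed.

Lemma psi_continuous p : (forall i, {for p, continuous (r i)}) ->
  {for p, continuous (fun q => psi A mu (W q))}.
Proof.
move=> cr; have [C C0 hC] := psi_remainder p.
have l0 := @cvg_l1norm_diff _ _ (nbhs_filter p) id p cr.
have l1 : \forall q \near p, l1norm (W q - W p) <= 1.
  by apply: (cvgr_le 0) => //=; exact: l0.
pose S q := \sum_i (r i q - r i p) * dpsi i (W p).
have S0 : S q @[q --> p] --> 0.
  have -> : 0 = \sum_(i < m) (r i p - r i p) * dpsi i (W p) :> R.
    by rewrite big1// => i _; rewrite subrr mul0r.
  apply: cvg_sum_ord => i; apply: cvgMr_tmp.
  by apply: cvgB; [exact: cr|exact: cvg_cst].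
pose Rem q := psi A mu (W q) - psi A mu (W p) - S q.
have R0 : Rem q @[q --> p] --> 0.
  apply/norm_cvg0P.
  apply: (@squeeze_cvgr _ _ _ _ (cst 0) (fun q => C * l1norm (W q - W p) ^+ 2)).
  - by near=> q; rewrite normr_ge0 /= hC//; near: q.
  - exact: cvg_cst.
  - have -> : 0 = C * (0 * 0) :> R by rewrite !mulr0.
    by apply: cvgMl_tmp; apply: cvgM; exact: l0.
have key : psi A mu (W p) + (S q + Rem q) @[q --> p] -->
    psi A mu (W p) + (0 + 0).
  by apply: cvgD; [exact: cvg_cst|exact: cvgD].
rewrite !addr0 in key; apply: cvg_trans key.
have -> // : (fun q => psi A mu (W q)) =
    (fun q => psi A mu (W p) + (S q + Rem q)).
by apply/funext => q; rewrite /Rem; ring.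
Unshelve. all: by end_near. Qed.

(** A directional derivative gives continuity only along its own line, which suffices for the
    remainder estimate in [is_derive_psi]. *)
Lemma derive_cvg_shift (f : E -> R) p v : derivable f p v ->
  f (h *: v + p) @[h --> 0^'] --> f p.
Proof.
move=> fd.
have -> : f p = f p + 0 * 'D_v f p by rewrite mul0r addr0.
have : f p + h * (h^-1 *: (f (h *: v + p) - f p)) @[h --> (0:R)^'] -->
  f p + 0 * 'D_v f p.
  apply: cvgD; first exact: cvg_cst.
  apply: cvgM; last exact: fd.
  by apply: cvg_within_filter; exact: cvg_id.
apply: cvg_trans; apply: near_eq_cvg; near=> h.
have h0 : h != 0 by near: h; exact: nbhs_dnbhs_neq.
by rewrite /= -[_ *: _]/(h^-1 * _) mulrA mulfV// mul1r addrC subrK.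
Unshelve. all: by end_near. Qed.

Lemma derive_line (f : E -> R) p v :
  'D_v f p = 'D_1 (fun h : R => f (h *: v + p)) 0.
Proof.
rewrite /derive; set g1 := fun h => h^-1 *: _; set g2 := fun h => h^-1 *: _.
suff -> : g1 = g2 by [].
by rewrite funeqE /g1 /g2 => h /=; rewrite addr0 scale0r add0r [_%:A]mulr1.
Qed.

Lemma is_derive_psi p v (dr : 'I_m -> R) :
  (forall i, is_derive p v (r i) (dr i)) ->
  is_derive p v (fun q => psi A mu (W q)) (\sum_i dr i * dpsi i (W p)).
Proof.
move=> hdr; have [C C0 hC] := psi_remainder p.
have cr i : r i (h *: v + p) @[h --> (0:R)^'] --> r i p.
  by apply: derive_cvg_shift; case: (hdr i).
have qr i : h^-1 *: (r i (h *: v + p) - r i p) @[h --> (0:R)^'] --> dr i.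
  by case: (hdr i) => dri <-; exact: dri.
have l0 := @cvg_l1norm_diff _ _ _ (fun h => h *: v + p) p cr.
have l1 : \forall h \near (0:R)^', l1norm (W (h *: v + p) - W p) <= 1.
  by apply: (cvgr_le 0) => //=; exact: l0.
pose S h := \sum_i h^-1 *: (r i (h *: v + p) - r i p) * dpsi i (W p).
have Sd : S h @[h --> 0^'] --> \sum_i dr i * dpsi i (W p).
  by apply: cvg_sum_ord => i; apply: cvgMr_tmp; exact: qr.
pose Rem h := h^-1 *: (psi A mu (W (h *: v + p)) - psi A mu (W p)) - S h.
have R0 : Rem h @[h --> 0^'] --> 0.
  apply/norm_cvg0P.
  (* The quadratic remainder divided by [h] is bounded by an increment, tending to zero, times a sum
     of absolute difference quotients, which converges. *)
  apply: (@squeeze_cvgr _ _ _ _ (cst 0)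
    (fun h => C * (l1norm (W (h *: v + p) - W p) *
       (\sum_i `|h^-1 *: (r i (h *: v + p) - r i p)|)))).
  - near=> h; rewrite normr_ge0 /=.
    have -> : Rem h = h^-1 * (psi A mu (W (h *: v + p)) - psi A mu (W p) -
        \sum_i (r i (h *: v + p) - r i p) * dpsi i (W p)).
      rewrite mulrBr /Rem /S mulr_sumr; congr (_ - _).
      by apply: eq_bigr => i _; rewrite mulrA.
    rewrite normrM mulrC; apply: le_trans (ler_wpM2r _ (hC _ _)) _ => //.
      by near: h.
    rewrite -mulrA ler_wpM2l// expr2 -mulrA ler_wpM2l ?l1norm_ge0//.
    rewrite /l1norm mulr_suml ler_sum// => i _.
    by rewrite !mxE normrM mulrC.
  - exact: cvg_cst.
  - rewrite [X in _ --> X](_ : 0 = C * (0 * \sum_i `|dr i|)); last first.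
      by rewrite mul0r mulr0.
    apply: cvgMl_tmp; apply: cvgM; first exact: l0.
    by apply: cvg_sum_ord => i; apply: cvg_norm; exact: qr.
have D : h^-1 *: (psi A mu (W (h *: v + p)) - psi A mu (W p))
    @[h --> (0:R)^'] --> \sum_i dr i * dpsi i (W p).
  have -> : (fun h => h^-1 *: (psi A mu (W (h *: v + p)) - psi A mu (W p))) =
    (fun h => S h + Rem h).
    by apply/funext => h; rewrite /Rem; ring.
  by rewrite -[X in _ --> X]addr0; exact: cvgD.
by apply: DeriveDef; [apply/cvg_ex; eexists; exact: D|exact: cvg_lim D].
Unshelve. all: by end_near. Qed.

End psi_derive.

(** * A class of functions closed under directional derivatives *)

Section smooth_class.
Context {R : realType} {m : nat} {E : normedModType R}.
Variables (A : nat -> 'rV[R]_m) (U : set E).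

(** Smoothness of all orders follows once a single derivative preserves membership. [se_psi] admits
    every rapid [mu] because differentiation changes the coefficients; [se_inv] and [se_ln] ask for
    positivity only on [U], where derivatives are taken. *)
Inductive smooth_expr : (E -> R) -> Prop :=
| se_cst c : smooth_expr (fun=> c)
| se_lin (f : E -> R) : linear f -> continuous f -> smooth_expr f
| se_add f g : smooth_expr f -> smooth_expr g ->
    smooth_expr (fun p => f p + g p)
| se_mul f g : smooth_expr f -> smooth_expr g ->
    smooth_expr (fun p => f p * g p)
| se_inv f : smooth_expr f -> (forall p, U p -> 0 < f p) ->
    smooth_expr (fun p => (f p)^-1)
| se_ln f : smooth_expr f -> (forall p, U p -> 0 < f p) ->
    smooth_expr (fun p => ln (f p))
| se_psi mu (r : 'I_m -> E -> R) : rapid A mu ->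
    (forall i, smooth_expr (r i)) ->
    smooth_expr (fun p => psi A mu (\row_i r i p)).

Lemma se_sum (I : Type) (s : seq I) (f : I -> E -> R) :
  (forall i, smooth_expr (f i)) -> smooth_expr (fun p => \sum_(i <- s) f i p).
Proof.
move=> hf; elim: s => [|i s IH].
  rewrite (_ : (fun p => _) = fun=> 0); first exact: se_cst.
  by apply/funext => p; rewrite big_nil.
rewrite (_ : (fun p => _) = fun p => f i p + \sum_(i <- s) f i p).
  exact: se_add.
by apply/funext => p; rewrite big_cons.
Qed.

Lemma smooth_expr_continuous f : smooth_expr f ->
  forall p, U p -> {for p, continuous f}.
Proof.
elim=> {f} [c p Up|f lf cf p Up|f g _ IHf _ IHg p Up|f g _ IHf _ IHg p Up
  |f _ IHf f0 p Up|f _ IHf f0 p Up|mu r rmu _ IHr p Up].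
- exact: cvg_cst.
- exact: cf.
- by apply: cvgD; [exact: IHf|exact: IHg].
- by apply: cvgM; [exact: IHf|exact: IHg].
- by apply: cvgV; [rewrite gt_eqF// f0|exact: IHf].
- apply: (@continuous_comp _ _ _ f (@ln R)); first exact: IHf.
  by apply: continuous_ln; exact: f0.
- by apply: psi_continuous => // i; exact: IHr.
Qed.

Lemma smooth_expr_derive f : smooth_expr f ->
  forall v, exists2 g, smooth_expr g & forall p, U p -> is_derive p v f (g p).
Proof.
elim=> {f} [c v|f lf cf v|f g sf IHf sg IHg v|f g sf IHf sg IHg v
  |f sf IHf f0 v|f sf IHf f0 v|mu r rmu sr IHr v].
- by exists (fun=> 0); [exact: se_cst|move=> p _; exact: is_derive_cst].
- exists (fun=> f v); [exact: se_cst|move=> p _].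
  pose F : {linear E -> R} := HB.pack f (GRing.isLinear.Build _ _ _ _ f lf).
  have dF : differentiable F p by exact: linear_differentiable.
  apply: DeriveDef; first exact: (@diff_derivable _ _ _ F p v dF).
  by rewrite (@deriveE _ _ _ F p v dF) diff_lin.
- have [f' sf' df] := IHf v; have [g' sg' dg] := IHg v.
  exists (fun p => f' p + g' p); first exact: se_add.
  by move=> p Up; have := df p Up; have := dg p Up => ? ?; exact: is_deriveD.
- have [f' sf' df] := IHf v; have [g' sg' dg] := IHg v.
  exists (fun p => f p * g' p + g p * f' p).
    by apply: se_add; exact: se_mul.
  by move=> p Up; have := df p Up; have := dg p Up => ? ?; exact: is_deriveM.
- have [f' sf' df] := IHf v.
  exists (fun p => (-1 * ((f p)^-1 * (f p)^-1)) * f' p).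
    apply: se_mul => //; apply: se_mul; first exact: se_cst.
    by apply: se_mul; exact: se_inv.
  move=> p Up; have fp0 : f p != 0 by rewrite gt_eqF// f0.
  have [dfp <-] := df p Up.
  apply: DeriveDef; first exact: derivableV.
  by rewrite deriveV// mulN1r -invfM -expr2.
- have [f' sf' df] := IHf v.
  exists (fun p => (f p)^-1 * f' p).
    by apply: se_mul => //; exact: se_inv.
  move=> p Up; have [dfp <-] := df p Up.
  (* Restriction to the line through [p] in direction [v] makes the one-variable chain rule
     applicable to [ln]. *)
  pose F (h : R) := f (h *: v + p).
  have F0 : F 0 = f p by rewrite /F scale0r add0r.
  have dF : is_derive (0 : R) 1 F ('D_v f p).
    apply: DeriveDef; first exact: (derivable1P f p v).1 dfp.
    exact/esym/derive_line.
  have dln : is_derive (F 0) 1 (@ln R) (F 0)^-1.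
    by apply: is_derive1_ln; rewrite F0; exact: f0.
  have [dlF lF] : is_derive (0 : R) 1 ((@ln R) \o F) ((F 0)^-1 * 'D_v f p).
    exact: is_derive1_comp.
  apply: DeriveDef; first exact/derivable1P.
  by rewrite -F0 -lF; exact: derive_line.
- have /choice[r' hr'] : forall i, exists g : E -> R, smooth_expr g /\
      forall p, U p -> is_derive p v (r i) (g p).
    by move=> i; have [g sg dg] := IHr i v; exists g.
  exists (fun p =>
    \sum_i r' i p * psi A (fun k => mu k * A k 0 i) (\row_i r i p)).
    apply: se_sum => i; apply: se_mul; first exact: (hr' i).1.
    by apply: se_psi => //; exact: rapid_coord.
  by move=> p Up; apply: is_derive_psi => // i; exact: (hr' i).2.
Qed.

(** By induction on [vs], each iterated derivative agrees on [U] with a member of the class; as [U]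
    is open, the agreement holds near each point and survives the next derivative. *)
Lemma smooth_expr_smooth_on f f' : open U -> smooth_expr f' ->
  (forall p, U p -> f p = f' p) -> smooth_on U f.
Proof.
move=> oU sf ff' vs.
have [g sg fg] : exists2 g, smooth_expr g &
    forall p, U p -> iter_dderiv vs f p = g p.
  elim: vs => [|v vs [g sg fg]]; first by exists f'.
  have [g' sg' dg] := smooth_expr_derive sg v.
  exists g' => // p Up /=; have [_ <-] := dg p Up.
  by apply: near_eq_derive; near=> q; apply: fg; near: q; exact: open_nbhs_nbhs.
move=> p Up.
have nfg : \near p, g p = iter_dderiv vs f p.
  by near=> q; apply/esym/fg; near: q; exact: open_nbhs_nbhs.
split.
  have cg : g q @[q --> p] --> iter_dderiv vs f p.
    by rewrite (fg _ Up); exact: (smooth_expr_continuous sg Up).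
  by apply: cvg_trans cg; exact: near_eq_cvg.
move=> v; have [g' _ dg] := smooth_expr_derive sg v.
by apply: (near_eq_derivable nfg); case: (dg p Up).
Unshelve. all: by end_near. Qed.

End smooth_class.

(** * Countably many affine minorants *)

Section nearest_point.
Context {R : realType} {n : nat}.
Local Notation E := (R * 'rV[R]_n)%type.
Implicit Types p q c : E.

(** Euclidean, because the variational inequality needs an inner product and the maximum norm
    carried by the product does not come from one. *)
Definition sqdist p c : R :=
  (c.1 - p.1) ^+ 2 + dot (c.2 - p.2) (c.2 - p.2).

Lemma sqdist_continuous p : continuous (sqdist p).
Proof.
move=> c.
have -> : sqdist p = (fun c : E => (c.1 - p.1) * (c.1 - p.1) +
    \sum_i (c.2 0 i - p.2 0 i) * (c.2 0 i - p.2 0 i)).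
  apply/funext => d; rewrite /sqdist expr2 dotE; congr (_ + _).
  by apply: eq_bigr => i _; rewrite !mxE.
have c1 : d.1 - p.1 @[d --> c] --> c.1 - p.1.
  by apply: cvgB; [exact: cvg_fst|exact: cvg_cst].
apply: cvgD; first exact: cvgM.
apply: cvg_sum_ord => i.
have c2 : (fun d : E => d.2 0 i - p.2 0 i) @ c --> c.2 0 i - p.2 0 i.
  apply: cvgB; last exact: cvg_cst.
  apply: (@continuous_comp _ _ _ snd (fun y : 'rV[R]_n => y 0 i)).
    exact: cvg_snd.
  exact: coord_continuous.
exact: cvgM.
Qed.

(** Points of [C] no farther than a given [c0] lie in a compact box, where the continuous [sqdist p]
    attains its minimum. *)
Lemma closed_nearest (C : set E) p : closed C -> C !=set0 ->
  exists2 c, C c & forall q, C q -> sqdist p c <= sqdist p q.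
Proof.
(* Adding [1] gives [rho >= 1], hence [rho ^+ 2 >= sqdist p c0], so [rho] serves as a radius without
   a square root. *)
move=> clC [c0 Cc0]; pose rho := sqdist p c0 + 1.
have sq1 q : (q.1 - p.1) ^+ 2 <= sqdist p q by rewrite lerDl dot_ge0.
have sq2 q i : (q.2 0 i - p.2 0 i) ^+ 2 <= sqdist p q.
  apply: le_trans (_ : dot (q.2 - p.2) (q.2 - p.2) <= _); last first.
    by rewrite lerDr sqr_ge0.
  rewrite dotE (bigD1 i)//= !mxE -expr2 lerDl sumr_ge0// => j _.
  by rewrite -expr2 sqr_ge0.
have rho1 : 1 <= rho by rewrite lerDr (le_trans _ (sq1 c0)) ?sqr_ge0.
have itv (x y : R) : (x - y) ^+ 2 <= sqdist p c0 ->
    x \in `[y - rho, y + rho]%classic.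
  move=> h; rewrite inE /= in_itv/=; have : (x - y) ^+ 2 <= rho ^+ 2.
    rewrite (le_trans h)// expr2; apply: le_trans (_ : rho <= _).
      by rewrite lerDl.
    by rewrite ler_peMl// (le_trans _ rho1).
  rewrite -ler_sqrt ?sqr_ge0// !sqrtr_sqr (ger0_norm (le_trans ler01 rho1)).
  rewrite ler_norml; lra.
pose I i := `[p.2 0 i - rho, p.2 0 i + rho]%classic.
pose B : set E := `[p.1 - rho, p.1 + rho] `*`
  [set z : 'rV[R]_n | forall i, I i (z ord0 i)].
pose K := C `&` B.
have KP q : C q -> sqdist p q <= sqdist p c0 -> K q.
  move=> Cq hq; split=> //; split => /=.
    by have := itv q.1 p.1 (le_trans (sq1 q) hq); rewrite inE.
  move=> i; have := itv (q.2 0 i) (p.2 0 i) (le_trans (sq2 q i) hq).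
  by rewrite inE.
have cptB : compact B.
  apply: compact_setX; first exact: segment_compact.
  by apply: (@rV_compact R n I) => i; exact: segment_compact.
have cptK : compact K.
  apply: (subclosed_compact _ cptB); last by move=> q [].
  apply: closedI => //; apply: compact_closed => //.
have K0 : K !=set0 by exists c0; exact: KP.
have [c /set_mem [Cc _] hc] := compact_EVT_min K0 cptK
  (continuous_subspaceT (@sqdist_continuous p)).
exists c => // q Cq.
have [qc|/ltW qc] := leP (sqdist p q) (sqdist p c0).
  by apply: hc; rewrite inE; exact: KP.
by apply: le_trans (hc c0 _) qc; rewrite inE; exact: KP.
Qed.

(** Moving from [c] towards [q] by a fraction [l] changes the squared distance by
    [l * (2 * B + l * D)], which cannot be negative. *)
Lemma nearest_variational (C : set E) p c :
  (forall q (l : R), C q -> 0 < l < 1 -> C (c + l *: (q - c))) ->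
  (forall q, C q -> sqdist p c <= sqdist p q) ->
  forall q, C q -> 0 <= (c.1 - p.1) * (q.1 - c.1) + dot (c.2 - p.2) (q.2 - c.2).
Proof.
move=> cvC minc q Cq; set B := (X in 0 <= X).
pose D := (q.1 - c.1) ^+ 2 + dot (q.2 - c.2) (q.2 - c.2).
have D0 : 0 <= D by rewrite addr_ge0 ?sqr_ge0 ?dot_ge0.
have key l : 0 < l < 1 -> 0 <= 2 * B + l * D.
  move=> l01; have := minc _ (cvC q l Cq l01).
  have -> : sqdist p (c + l *: (q - c)) = sqdist p c + l * (2 * B + l * D).
    rewrite /sqdist /B /D /=.
    have -> : c.2 + l *: (q.2 - c.2) - p.2 = (c.2 - p.2) + l *: (q.2 - c.2).
      by rewrite addrAC.
    rewrite -[l *: (q.1 - c.1)]/(l * _).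
    move: (c.2 - p.2) (q.2 - c.2) => u w.
    rewrite !(dotDl, dotDr, dotZl, dotZr) (dotC w u).
    set d1 := dot _ _; set d2 := dot _ _; set d3 := dot _ _; ring.
  by rewrite lerDl pmulr_rge0//; case/andP: l01.
rewrite leNgt; apply/negP => B0.
(* For negative [B], the fraction [1 / 2] gives a contradiction when [- B >= D + 1]; otherwise
   [- B / (D + 1)] is below [1] and does so. *)
have [DB|DB] := leP (D + 1) (- B).
  by have := key 2^-1; have : (0 < 2^-1 :> R) by []; nra.
have h : 0 < - B / (D + 1) < 1 by rewrite divr_gt0 ?ltr_pdivrMr; lra.
have := key _ h.
have : - B / (D + 1) * D <= - B.
  rewrite mulrAC ler_pdivrMr; last by lra.
  nra.
lra.
Qed.

End nearest_point.

(** * Epigraphs and affine minorants *)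

Section minorants.
Context {R : realType} {n : nat}.
Implicit Types (Phi : 'rV[R]_n -> \bar R) (y z : 'rV[R]_n) (A : 'rV[R]_(1 + n)).

(** Homogeneous coordinates: the affine function [b + dot a y] becomes linear and is stored as the
    single vector [row_mx b%:M a]. *)
Definition homog y : 'rV[R]_(1 + n) := row_mx 1%:M y.

Lemma dot_row_mx (b : R) a y : dot (row_mx b%:M a) (homog y) = b + dot a y.
Proof.
rewrite /dot /homog tr_row_mx mul_row_col mxE; congr (_ + _).
by rewrite trmx1 mulmx1 mxE eqxx.
Qed.

Lemma homogD y (t : R) z :
  homog (t *: y + (1 - t) *: z) = t *: homog y + (1 - t) *: homog z.
Proof.
rewrite /homog !scale_row_mx add_row_mx; congr row_mx.
by rewrite -scalerDl addrC subrK scale1r.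
Qed.

Definition minorant Phi A := forall y, ((dot A (homog y))%:E <= Phi y)%E.

Definition epi Phi : set (R * 'rV[R]_n) := [set p | (Phi p.2 <= p.1%:E)%E].

(** Off the epigraph, a real [a] fits strictly between the height and the value; nearby, [Phi] stays
    above [a] by semicontinuity and the height stays below it. *)
Lemma closed_epi Phi : lower_semicontinuous Phi -> closed (epi Phi).
Proof.
move=> lsc; rewrite -openC openE => p /= /negP; rewrite -ltNge => hp.
have [a pa aPhi] : exists2 a : R, p.1 < a & (a%:E < Phi p.2)%E.
  case: (Phi p.2) hp => [s| |] //; rewrite ?lte_fin => hp.
    by exists ((p.1 + s) / 2); rewrite ?lte_fin midf_lt.
  by exists (p.1 + 1); rewrite ?ltry// ltrDl.
have [V nV hV] := lsc _ _ aPhi.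
have n1 : \forall q \near p, q.1 < a.
  have fp : (fst : R * 'rV[R]_n -> _) @ p --> p.1 by exact: cvg_fst.
  exact: (cvgr_lt _ fp).
have n2 : \forall q \near p, V q.2.
  have sp : (snd : R * 'rV[R]_n -> _) @ p --> p.2 by exact: cvg_snd.
  exact: (sp V nV).
near=> q; apply/negP; rewrite -ltNge.
have /hV : V q.2 by near: q.
by apply: lt_trans; rewrite lte_fin; near: q.
Unshelve. all: by end_near. Qed.

Lemma convex_epi Phi (c q : R * 'rV[R]_n) (l : R) : econvex_on setT Phi ->
  epi Phi c -> epi Phi q -> 0 < l < 1 -> epi Phi (c + l *: (q - c)).
Proof.
move=> cvx; rewrite /epi /= => hc hq l01; have /andP[l0 l1] := l01.
have -> : c.2 + l *: (q.2 - c.2) = l *: q.2 + (1 - l) *: c.2.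
  by rewrite scalerBr scalerBl scale1r addrCA addrA.
apply: (le_trans (cvx q.2 c.2 l I I l01)).
apply: le_trans (_ : l%:E * q.1%:E + (1 - l)%:E * c.1%:E <= _)%E.
  by apply: leeD; apply: lee_wpmul2l => //; rewrite lee_fin ?subr_ge0 ltW.
rewrite -!EFinM -EFinD lee_fin -[l *: (q.1 - c.1)]/(l * _); lra.
Qed.

Lemma rat_approx (x d : R) : 0 < d -> exists q : rat, `|x - ratr q| < d.
Proof.
move=> d0; have [|q] := @rat_in_itvoo R (x - d) (x + d); first by lra.
by rewrite in_itv/= => qd; exists q; rewrite ltr_norml; lra.
Qed.

(** * Separation of points from the epigraph *)

Section separation.
Variable Phi : 'rV[R]_n -> \bar R.
Hypotheses (pPhi : proper_fun Phi) (lscPhi : lower_semicontinuous Phi)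
  (cvxPhi : econvex_on setT Phi).

(** Here [c] is the point of the epigraph nearest to [(r, y0)]. Testing its variational inequality
    with the point one unit above [c] gives [r <= c.1]; equality means a vertical hyperplane. *)
Lemma epi_separation y0 (r : R) : (r%:E < Phi y0)%E ->
  exists c : R * 'rV[R]_n, [/\ epi Phi c, r <= c.1,
    r = c.1 -> c.2 != y0 &
    forall q, epi Phi q ->
      0 <= (c.1 - r) * (q.1 - c.1) + dot (c.2 - y0) (q.2 - c.2)].
Proof.
move=> hr; have [nNy [y1 /eqP y1y]] := pPhi.
have epi0 : epi Phi !=set0.
  exists (fine (Phi y1), y1); rewrite /epi /= fineK//.
  by rewrite fin_numE nNy; apply/eqP.
have [c Cc minc] := closed_nearest (r, y0) (closed_epi lscPhi) epi0.
have var := nearest_variational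
  (fun q l Cq => convex_epi cvxPhi Cc Cq) minc.
exists c; split => //=.
  have Cc1 : epi Phi (c.1 + 1, c.2).
    by apply: le_trans Cc _; rewrite lee_fin lerDl.
  have := var _ Cc1; rewrite /= subrr dotC dot0l addr0; lra.
move=> rc; apply: contraTneq hr => <-.
by rewrite -leNgt rc.
Qed.

Lemma fin_dom z : (Phi z < +oo)%E -> Phi z \is a fin_num.
Proof. by move=> hz; rewrite fin_numE (pPhi.1 z) /= lt_eqF. Qed.

(** Dividing by [c.1 - r] turns the hyperplane into the graph of an affine function, whose value at
    [y0] is [c.1] plus a nonnegative multiple of [dot (c.2 - y0) (c.2 - y0)]. *)
Lemma minorant_nonvertical y0 (r : R) (c : R * 'rV[R]_n) : r < c.1 ->
  (forall q, epi Phi q ->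
    0 <= (c.1 - r) * (q.1 - c.1) + dot (c.2 - y0) (q.2 - c.2)) ->
  exists2 A, minorant Phi A & r < dot A (homog y0).
Proof.
rewrite -subr_gt0 => d0 ineq.
pose g := (c.1 - r)^-1 *: (c.2 - y0).
exists (row_mx (c.1 + dot g c.2)%:M (- g)).
  move=> z; rewrite dot_row_mx dotNl.
  have [zy|] := eqVneq (Phi z) +oo%E; first by rewrite zy leey.
  rewrite -ltey => /fin_dom fz; rewrite -(fineK fz) lee_fin.
  have /ineq : epi Phi (fine (Phi z), z) by rewrite /epi /= fineK.
  have -> : dot (c.2 - y0) (z - c.2) = (c.1 - r) * (dot g z - dot g c.2).
    by rewrite /g !dotZl dotDr dotNr -mulrBr mulrA mulfV ?mul1r// gt_eqF.
  by rewrite -mulrDr pmulr_rge0//=; lra.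
rewrite dot_row_mx dotNl -addrA -dotNr -dotDr /g dotZl.
have : 0 <= (c.1 - r)^-1 * dot (c.2 - y0) (c.2 - y0).
  by rewrite mulr_ge0 ?dot_ge0// invr_ge0 ltW.
lra.
Qed.

(** Separation is applied one unit below a point of the graph; a vertical hyperplane is contradicted
    by that graph point itself. *)
Lemma minorant_exists : exists A, minorant Phi A.
Proof.
have [nNy [y1 y1y]] := pPhi.
have fy : Phi y1 \is a fin_num by rewrite fin_numE nNy.
pose r := fine (Phi y1) - 1.
have hr : (r%:E < Phi y1)%E by rewrite -(fineK fy) lte_fin /r; lra.
have [c [Cc rc1 rc ineq]] := epi_separation hr.
have [rc2|rc2] := eqVneq r c.1; last first.
  have [|A mA _] := @minorant_nonvertical y1 r c _ ineq; last by exists A.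
  by rewrite lt_neqAle rc2.
have /ineq : epi Phi (fine (Phi y1), y1) by rewrite /epi /= fineK.
rewrite /= -rc2 subrr mul0r add0r -(opprB c.2 y1) dotNr oppr_ge0 => h.
have : dot (c.2 - y1) (c.2 - y1) == 0 by rewrite eq_le h dot_ge0.
by rewrite dot_eq0 subr_eq0 (negbTE (rc rc2)).
Qed.

(* In the vertical case the separating hyperplane only sees the domain of Phi;
   a large multiple of it is added to any affine minorant. *)
Lemma minorant_gt y0 (r : R) : (r%:E < Phi y0)%E ->
  exists2 A, minorant Phi A & r < dot A (homog y0).
Proof.
move=> hr; have [c [Cc rc1 rc ineq]] := epi_separation hr.
have [rc2|rc2] := eqVneq r c.1; last first.
  by apply: minorant_nonvertical ineq; rewrite lt_neqAle rc2.
have [A mA] := minorant_exists.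
(* At [y0] the added multiple contributes [K * dot d d], one more than the distance from [r] to the
   value of [A] there. *)
pose d := c.2 - y0; pose K := (`|r - dot A (homog y0)| + 1) / dot d d.
have d0 : 0 < dot d d.
  by rewrite lt_neqAle dot_ge0 andbT eq_sym dot_eq0 subr_eq0 rc.
have K0 : 0 <= K by rewrite divr_ge0 ?dot_ge0// addr_ge0.
exists (A + row_mx (K * dot d c.2)%:M (- (K *: d))).
  move=> z; rewrite dotDl dot_row_mx dotNl dotZl.
  have [zy|] := eqVneq (Phi z) +oo%E; first by rewrite zy leey.
  rewrite -ltey => /fin_dom fz; apply: le_trans (mA z); rewrite lee_fin.
  have /ineq : epi Phi (fine (Phi z), z) by rewrite /epi /= fineK.
  rewrite -rc2 subrr mul0r add0r /= -/d dotDr dotNr; nra.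
rewrite dotDl dot_row_mx dotNl dotZl.
have -> : K * dot d c.2 - K * dot d y0 = `|r - dot A (homog y0)| + 1.
  by rewrite -mulrBr -(dotNr d) -(dotDr d) -/d /K mulfVK// gt_eqF.
have := ler_norm (r - dot A (homog y0)); lra.
Qed.

(** For every rational vector and radius [1 / (j + 1)], one minorant within that radius is chosen if
    any exists. The chosen ones are dense among all minorants, so a strict inequality at [y] passes
    to one of them. *)
Lemma countable_minorants A0 : minorant Phi A0 ->
  exists A : nat -> 'rV[R]_(1 + n), [/\ A 0%N = A0,
    forall k, minorant Phi (A k) &
    forall y (r : R), (r%:E < Phi y)%E -> exists k, r < dot (A k) (homog y)].
Proof.
move=> mA0.
pose near (t : 'rV[rat]_(1 + n) * nat) A :=
  l1norm (A - map_mx ratr t.1) < t.2.+1%:R^-1.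
have /choice[P hP] : forall t, exists B, minorant Phi B /\
    ((exists2 A, minorant Phi A & near t A) -> near t B).
  move=> t.
  have [[A mA tA]|no] := pselect (exists2 A, minorant Phi A & near t A).
    by exists A.
  by exists A0; split.
(* Index [0] is reserved for [A0], which also fills the indices that decode to nothing. *)
pose B k := if k is k'.+1 then
  if unpickle k' is Some t then P t else A0 else A0.
exists B; split => //.
  move=> [|k] //=; case: unpickle => // t; exact: (hP t).1.
move=> y r /minorant_gt[A mA rA].
(* Two minorants within [e] of the same rational vector differ at [y] by at most
   [2 * e * l1norm (homog y)]; the [+ 1] keeps this strictly below the gap. *)
pose e := (dot A (homog y) - r) / 2 / (l1norm (homog y) + 1).
have hy0 := l1norm_ge0 (homog y).
have e0 : 0 < e by rewrite !divr_gt0 ?subr_gt0//; lra.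
pose j := Num.truncn e^-1.
have je : j.+1%:R^-1 < e.
  by rewrite invf_plt ?posrE// truncnS_gt.
(* Dividing by [n + 2] keeps the total error of the [n + 1] coordinates strictly below
   [1 / (j + 1)]. *)
have /choice[q hq] : forall i, exists q : rat,
    `|A 0 i - ratr q| < j.+1%:R^-1 / (1 + n).+1%:R.
  by move=> i; apply: rat_approx; rewrite divr_gt0 ?invr_gt0.
pose t := (\row_i q i, j).
have tA : near t A.
  rewrite /near /l1norm /t/=.
  apply: le_lt_trans (_ : \sum_(i < 1 + n) j.+1%:R^-1 / (1 + n).+1%:R < _).
    by apply: ler_sum => i _; rewrite !mxE ltW.
  rewrite sumr_const card_ord -[X in X < _]mulr_natr -mulrA gtr_pMr ?invr_gt0//.
  by rewrite ltr_pdivrMl// mulr1 ltr_nat.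
have [mP /(_ (ex_intro2 _ _ A mA tA)) tP] := hP t.
exists (pickle t).+1; rewrite /= pickleK.
have dP : `|dot (A - P t) (homog y)| <= (e + e) * l1norm (homog y).
  apply: le_trans (ler_norm_dot _ _) _; rewrite ler_wpM2r//.
  have -> : A - P t = (A - map_mx ratr t.1) - (P t - map_mx ratr t.1).
    by rewrite opprB addrA subrK.
  apply: le_trans (_ : l1norm (A - map_mx ratr t.1) +
    l1norm (P t - map_mx ratr t.1) <= _).
    rewrite /l1norm -big_split ler_sum// => i _.
    by rewrite !mxE -[X in _ <= _ + X]normrN ler_normD.
  by apply: lerD; rewrite ltW// (lt_trans _ je).
have : (e + e) * l1norm (homog y) < dot A (homog y) - r.
  rewrite /e; set N := l1norm _ in hy0 *; set g := _ - r.
  have g0 : 0 < g by rewrite subr_gt0.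
  rewrite -mulrDl -splitr mulrAC ltr_pdivrMr; last by lra.
  rewrite ltr_pM2l//; lra.
move: dP; rewrite dotDl dotNl ler_norml => /andP[_]; lra.
Qed.

End separation.
End minorants.

(** * The extension *)

Lemma cvge_order {R : realType} {T : Type} {F : set_system T} {FF : Filter F}
    (f : T -> \bar R) (l : \bar R) : l != -oo%E ->
  (forall a : R, (a%:E < l)%E -> \forall x \near F, (a%:E < f x)%E) ->
  (forall b : R, (l < b%:E)%E -> \forall x \near F, (f x < b%:E)%E) ->
  f x @[x --> F] --> l.
Proof.
case: l => [s| |] // _ lo up; last first.
  by apply/cvgeyPgt => M; apply: lo; rewrite ltry.
move=> B /= [e /= e0 eB].
have nlo : \forall x \near F, ((s - e)%:E < f x)%E.
  by apply: lo; rewrite lte_fin ltrBlDr ltrDl.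
have nup : \forall x \near F, (f x < (s + e)%:E)%E.
  by apply: up; rewrite lte_fin ltrDl.
rewrite nbhs_filterE /=; near=> x.
have h1 : ((s - e)%:E < f x)%E by near: x.
have h2 : (f x < (s + e)%:E)%E by near: x.
case fx : (f x) h1 h2 => [r| |] //; rewrite !lte_fin => h1 h2.
by rewrite /= fx; apply: eB; rewrite /ball_ /= ltr_norml; lra.
Unshelve. all: by end_near. Qed.

(** * Convexity of the exponential from its tangent lines *)

Section expR_convexity.
Context {R : realType}.

Lemma expR_tangent (a c : R) : expR c * (1 + (a - c)) <= expR a.
Proof.
have -> : expR a = expR c * expR (a - c) by rewrite -expRD subrKC.
by rewrite ler_pM2l ?expR_gt0// expR_ge1Dx.
Qed.

Lemma expR_tangent_lt (a c : R) : a != c -> expR c * (1 + (a - c)) < expR a.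
Proof.
move=> ac; have -> : expR a = expR c * expR (a - c) by rewrite -expRD subrKC.
by rewrite ltr_pM2l ?expR_gt0// expR_gt1Dx// subr_eq0.
Qed.

(** Tangent inequalities at the convex combination [c] are added with weights [l1] and [l2]; the
    first-order terms cancel. *)
Lemma expR_convex (l1 l2 a b : R) : 0 <= l1 -> 0 <= l2 -> l1 + l2 = 1 ->
  expR (l1 * a + l2 * b) <= l1 * expR a + l2 * expR b.
Proof.
move=> l10 l20 l12; set c := _ + _ * b.
have := ler_wpM2l l10 (expR_tangent a c).
have := ler_wpM2l l20 (expR_tangent b c).
have : l1 * (expR c * (1 + (a - c))) + l2 * (expR c * (1 + (b - c))) = expR c.
  have -> : l2 = 1 - l1 by lra.
  have -> : c = l1 * a + (1 - l1) * b by rewrite /c; congr (_ + _ * _); lra.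
  ring.
lra.
Qed.

(** The tangent inequality for [a] is strict, since [a - c = l2 * (a - b)] is nonzero. *)
Lemma expR_convex_lt (l1 l2 a b : R) : 0 < l1 -> 0 < l2 -> l1 + l2 = 1 ->
  a != b -> expR (l1 * a + l2 * b) < l1 * expR a + l2 * expR b.
Proof.
move=> l10 l20 l12 ab; set c := _ + _ * b.
have ac : a != c.
  apply: contraNneq ab => ac; have : l2 * (a - b) = 0.
    have -> : l2 * (a - b) = a - c.
      rewrite /c; have -> : l1 = 1 - l2 by lra.
      ring.
    by rewrite -ac subrr.
  by move/eqP; rewrite mulf_eq0 gt_eqF//= subr_eq0.
have : l1 * (expR c * (1 + (a - c))) < l1 * expR a.
  by rewrite ltr_pM2l// expR_tangent_lt.
have := ler_wpM2l (ltW l20) (expR_tangent b c).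
have : l1 * (expR c * (1 + (a - c))) + l2 * (expR c * (1 + (b - c))) = expR c.
  have -> : l2 = 1 - l1 by lra.
  have -> : c = l1 * a + (1 - l1) * b by rewrite /c; congr (_ + _ * _); lra.
  ring.
lra.
Qed.

End expR_convexity.

Section extension.
Context {R : realType} {n : nat}.
Local Notation E := (R * 'rV[R]_n)%type.
Variables (Phi : 'rV[R]_n -> \bar R) (A : nat -> 'rV[R]_(1 + n)).
Hypotheses (pPhi : proper_fun Phi) (cvxPhi : econvex_on setT Phi).
Hypothesis mA : forall k, minorant Phi (A k).
Hypothesis supA : forall y (r : R), (r%:E < Phi y)%E ->
  exists k, r < dot (A k) (homog y).

Local Notation ell k y := (dot (A k) (homog y)).

(** The Gaussian factor outweighs every exponential in [N = l1norm (A k)], through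
    [r * N - N ^+ 2 <= r ^+ 2]; the power of [2^-1] gives geometric decay in [k]. *)
Definition weight k : R := 2^-1 ^+ k * expR (- l1norm (A k) ^+ 2).

Lemma weight_gt0 k : 0 < weight k.
Proof. by rewrite mulr_gt0 ?expR_gt0// exprn_gt0// invr_gt0. Qed.

Lemma rapid_weight : rapid A weight.
Proof.
move=> r; exists (expR (r ^+ 2)) => k.
rewrite ger0_norm ?mulr_ge0 ?expR_ge0 ?exprn_ge0 ?invr_ge0//.
rewrite /weight -mulrA mulrC ler_wpM2r ?exprn_ge0 ?invr_ge0//.
by rewrite -expRD ler_expR; set N := l1norm _; nra.
Qed.

Definition persp (p : E) : 'rV[R]_(1 + n) := p.1^-1 *: homog p.2.
Definition partition_fun (p : E) : R := psi A weight (persp p).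
Definition softmax (p : E) : R := p.1 * ln (partition_fun p).
Definition extension (p : E) : \bar R :=
  if p.1 == 0 then Phi p.2 else (softmax p + p.1 ^+ 2)%:E.

Lemma dot_persp k p : dot (A k) (persp p) = ell k p.2 / p.1.
Proof. by rewrite /persp dotZr mulrC. Qed.

Lemma term_le_partition k p :
  weight k * expR (ell k p.2 / p.1) <= partition_fun p.
Proof.
rewrite -dot_persp /partition_fun /psi.
apply: (@ler_term_tsum _ (fun k => weight k * expR (dot (A k) (persp p)))).
  exact: psi_dominated rapid_weight.
by move=> j; rewrite mulr_ge0 ?expR_ge0// ltW ?weight_gt0.
Qed.

Lemma partition_gt0 p : 0 < partition_fun p.
Proof.
apply: lt_le_trans (term_le_partition 0 p).
by rewrite mulr_gt0 ?weight_gt0 ?expR_gt0.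
Qed.

Lemma softmax_le p s : 0 < p.1 ->
  (softmax p <= s) = (expR (- (s / p.1)) * partition_fun p <= 1).
Proof.
move=> p0; rewrite /softmax mulrC -ler_pdivlMr// -(ler_expR (ln _)).
rewrite lnK ?posrE ?partition_gt0//.
by rewrite expRN (mulrC _ (partition_fun p)) ler_pdivrMr ?expR_gt0// mul1r.
Qed.

Lemma softmax_lt p s : 0 < p.1 ->
  (softmax p < s) = (expR (- (s / p.1)) * partition_fun p < 1).
Proof.
move=> p0; rewrite /softmax mulrC -ltr_pdivlMr// -(ltr_expR (ln _)).
rewrite lnK ?posrE ?partition_gt0//.
by rewrite expRN (mulrC _ (partition_fun p)) ltr_pdivrMr ?expR_gt0// mul1r.
Qed.

Lemma expR_softmax p : 0 < p.1 ->
  expR (- (softmax p / p.1)) * partition_fun p = 1.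
Proof.
move=> p0; rewrite /softmax mulrAC mulfV ?gt_eqF// mul1r expRN.
by rewrite lnK ?posrE ?partition_gt0// mulVf// gt_eqF ?partition_gt0.
Qed.

(** For [p.1 > 0], only the term of index [k] is kept in the partition sum. *)
Lemma extension_ge k p : 0 <= p.1 ->
  ((ell k p.2 + p.1 * ln (weight k) + p.1 ^+ 2)%:E <= extension p)%E.
Proof.
rewrite le_eqVlt /extension => /predU1P[<-|p0].
  by rewrite eqxx mul0r expr0n/= !addr0; exact: mA.
rewrite gt_eqF// lee_fin lerD2r /softmax addrC.
have -> : ell k p.2 = p.1 * (ell k p.2 / p.1) by rewrite mulrC divfK// gt_eqF.
rewrite -mulrDr ler_pM2l// -ler_expR lnK ?posrE ?partition_gt0//.
by rewrite expRD lnK ?posrE ?weight_gt0// term_le_partition.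
Qed.

(** For [p.1 > 0], every affine function is replaced by its upper bound [Phi p.2], which factors out
    of the sum. *)
Lemma extension_le p : 0 <= p.1 ->
  (extension p <= Phi p.2 + (p.1 * ln (tsum weight) + p.1 ^+ 2)%:E)%E.
Proof.
rewrite le_eqVlt /extension => /predU1P[<-|p0].
  by rewrite eqxx mul0r expr0n/= addr0 adde0.
rewrite gt_eqF//.
have [->|fPhi] := eqVneq (Phi p.2) +oo%E; first by rewrite addye// leey.
have {}fPhi : Phi p.2 \is a fin_num by rewrite fin_numE pPhi.1.
rewrite -(fineK fPhi) -EFinD lee_fin addrA lerD2r.
have gw : geo_dominated weight.
  have := rapid_weight 0; congr geo_dominated; apply/funext => k.
  by rewrite mul0r expR0 mulr1.
have tw : 0 < tsum weight.
  apply: lt_le_trans (weight_gt0 0) _; apply: ler_term_tsum => // k.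
  exact/ltW/weight_gt0.
rewrite /softmax -ler_pdivlMl// mulrDr mulKf ?gt_eqF// -ler_expR.
rewrite expRD !lnK ?posrE ?partition_gt0// -tsumZ// ler_tsum//.
- exact: psi_dominated rapid_weight.
- exact: geo_dominatedZ.
move=> k; rewrite dot_persp mulrC ler_wpM2r ?(ltW (weight_gt0 k))//.
rewrite ler_expR mulrC ler_wpM2l ?invr_ge0 ?(ltW p0)//.
by rewrite -lee_fin fineK// mA.
Qed.

Lemma extensionNy p : 0 <= p.1 -> extension p != -oo%E.
Proof.
by move=> /(extension_ge 0) h; rewrite gt_eqF// (lt_le_trans _ h)// ltNyr.
Qed.

(** * Smoothness in the open half-space and behaviour at the boundary *)

Lemma open_half_open : open (@open_half R n).
Proof.
rewrite openE => p /= p0.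
have fp : (fst : E -> _) @ p --> p.1 by exact: cvg_fst.
exact: (cvgr_gt _ fp).
Qed.

Lemma smooth_extension :
  smooth_on (@open_half R n) (fun p => fine (extension p)).
Proof.
apply: (@smooth_expr_smooth_on _ _ _ A _ _ (fun p => softmax p + p.1 * p.1)).
- exact: open_half_open.
- have sfst : smooth_expr A (@open_half R n) (fun p => p.1).
    by apply: se_lin => // p; exact: cvg_fst.
  apply: se_add; apply: se_mul => //.
  apply: se_ln; last by move=> p _; exact: partition_gt0.
  pose r i (p : E) : R := p.1^-1 * homog p.2 0 i.
  have -> : partition_fun = fun p => psi A weight (\row_i r i p).
    apply/funext => p; congr psi.
    by apply/rowP => i; rewrite /r !mxE.
  apply: se_psi => [|i]; first exact: rapid_weight.
  apply: se_mul; first by apply: se_inv.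
  (* [homog] is affine, not linear: its leading coordinate is constant and the others are linear
     projections. *)
  rewrite -[i]splitK; case: (fintype.split i) => j.
    rewrite (_ : (fun p => _) = fun=> (1%:M : 'M[R]_1) 0 j).
      exact: se_cst.
    by apply/funext => p; rewrite /homog row_mxEl.
  rewrite (_ : (fun p => _) = fun p : E => p.2 0 j); last first.
    by apply/funext => p; rewrite /homog row_mxEr.
  apply: se_lin.
    by move=> a u v; rewrite /= !mxE.
  move=> p; apply: (@continuous_comp _ _ _ snd (fun y : 'rV[R]_n => y 0 j)).
    exact: cvg_snd.
  exact: coord_continuous.
- by move=> p /= p0; rewrite /extension gt_eqF.
Qed.

Lemma open_half_fin p : @open_half R n p -> extension p \is a fin_num.
Proof. by move=> p0; rewrite /extension gt_eqF. Qed.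

Lemma extension_cvg_open p : @open_half R n p ->
  extension q @[q --> p] --> extension p.
Proof.
move=> p0; have [cf _] := smooth_extension [::] p0.
rewrite -(fineK (open_half_fin p0)).
apply/fine_cvgP; split; last exact: cf.
have : nbhs p (@open_half R n).
  by apply: open_nbhs_nbhs; split => //; exact: open_half_open.
by apply: filterS => q; exact: open_half_fin.
Qed.

(** At a boundary point, an affine function exceeding [a] gives, through [extension_ge], a
    continuous lower bound with the same value there; inside, continuity is enough. *)
Lemma lsc_extension : lsc_within (@closed_half R n) extension.
Proof.
move=> p; rewrite /closed_half /= le_eqVlt => /predU1P[p0|p0] a ap.
  move: ap; rewrite /extension -p0 eqxx => /supA[k ak].
  pose f (q : E) := ell k q.2 + q.1 * ln (weight k) + q.1 * q.1.
  have fp : (fst : E -> _) @ p --> p.1 by exact: cvg_fst.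
  have cf : f @ p --> f p.
    apply: cvgD; last exact: cvgM.
    apply: cvgD; last by apply: cvgMr_tmp.
    have -> : (fun q : E => ell k q.2) =
        (fun q => A k 0 (lshift n 0) + \sum_i A k 0 (rshift 1 i) * q.2 0 i).
      apply/funext => q.
      rewrite dotE big_split_ord/= big_ord1 row_mxEl mxE eqxx mulr1.
      by congr (_ + _); apply: eq_bigr => i _; rewrite row_mxEr.
    rewrite dotE big_split_ord/= big_ord1 row_mxEl mxE eqxx mulr1.
    apply: cvgD; first exact: cvg_cst.
    apply: cvg_sum_ord => i; apply: cvgMl_tmp; rewrite row_mxEr.
    apply: (@continuous_comp _ _ _ snd (fun y : 'rV[R]_n => y 0 i)).
      exact: cvg_snd.
    exact: coord_continuous.
  have af : \forall q \near p, a < f q.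
    by apply: (cvgr_gt _ cf); rewrite /f -p0 !mul0r !addr0.
  near=> q => q0; apply: lt_le_trans (extension_ge k q0).
  by rewrite lte_fin expr2; near: q.
have := extension_cvg_open p0 => cp.
have : \forall q \near p, (a%:E < extension q)%E.
  exact: (cp _ (open_ereal_gt' ap)).
by apply: filterS.
Unshelve. all: by end_near. Qed.

(** A general filter serves both the limit with [y] fixed and continuity at the boundary. Lower
    bounds come from [lsc_extension], upper ones from [extension_le] and the last hypothesis. *)
Lemma extension_cvg_boundary {T : Type} {F : set_system T} {FF : Filter F}
    (g : T -> E) y :
  g x @[x --> F] --> (0, y) ->
  (\forall x \near F, 0 <= (g x).1) ->
  (forall b : R, (Phi y < b%:E)%E ->
    \forall x \near F, (Phi (g x).2 < b%:E)%E) ->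
  extension (g x) @[x --> F] --> Phi y.
Proof.
move=> gy g0 up; apply: cvge_order; first exact: pPhi.1.
  move=> a aPhi.
  have : (a%:E < extension (0%R, y))%E by rewrite /extension eqxx.
  move=> /(@lsc_extension (0, y) (lexx 0) a)/(gy _) h.
  by apply: filterS2 g0 h => x x0 /(_ x0).
move=> b yb.
(* An intermediate [c] leaves the margin [b - c] for the error term of [extension_le]. *)
have [c yc cb] : exists2 c : R, (Phi y < c%:E)%E & c < b.
  case: (Phi y) yb (pPhi.1 y) => [s| |] //; rewrite lte_fin => sb _.
  by exists ((s + b) / 2); rewrite ?lte_fin midf_lt.
pose err (t : R) := t * ln (tsum weight) + t * t.
have g1 : (g x).1 @[x --> F] --> 0.
  by apply: (@cvg_comp _ _ _ g fst _ _ _ gy); exact: cvg_fst.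
have err0 : err (g x).1 @[x --> F] --> 0.
  rewrite [X in _ --> X](_ : 0 = 0 * ln (tsum weight) + 0 * 0); last first.
    by rewrite !mul0r addr0.
  by apply: cvgD; [apply: cvgMr_tmp|apply: cvgM].
have ne : \forall x \near F, err (g x).1 < b - c.
  by apply: (cvgr_lt _ err0); rewrite subr_gt0.
have nc := up c yc.
near=> x; apply: le_lt_trans (extension_le _) _; first by near: x.
have h1 : (Phi (g x).2 < c%:E)%E by near: x.
have h2 : err (g x).1 < b - c by near: x.
have : ((err (g x).1)%:E < (b - c)%:E)%E by rewrite lte_fin.
move=> /(lteD h1); rewrite -EFinD subrKC; apply: le_lt_trans.
by rewrite /err expr2.
Unshelve. all: by end_near. Qed.

Lemma extension_limit y : extension (x, y) @[x --> 0^'+] --> Phi y.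
Proof.
apply: (@extension_cvg_boundary _ _ _ (fun x => (x, y))).
- have c0 : id @ (0 : R)^'+ --> (0 : R).
    by apply: cvg_within_filter; exact: cvg_id.
  have cy : (fun=> y) @ (0 : R)^'+ --> y by exact: cvg_cst.
  exact: (cvg_pair c0 cy).
- by near=> x => /=; apply: ltW; near: x; exact: nbhs_right_gt.
- by move=> b yb; exact: nearW.
Unshelve. all: by end_near. Qed.

Lemma extension_continuous : continuous Phi ->
  {within @closed_half R n, continuous extension}.
Proof.
move=> cPhi.
suff key p : @closed_half R n p ->
    extension q @[q --> within (@closed_half R n) (nbhs p)] --> extension p by apply/subspace_continuousP; exact: key.
case: p => x y.
rewrite {1}/closed_half /= le_eqVlt => /predU1P[<-|x0]; last first.
  by apply: cvg_within_filter; exact: extension_cvg_open.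
rewrite [X in _ --> X](_ : _ = Phi y); last by rewrite /extension eqxx.
apply: (@extension_cvg_boundary _ _ _ id).
- by apply: cvg_within_filter; exact: cvg_id.
- exact: withinT.
move=> b yb; apply: cvg_within.
have sp : (snd : E -> _) @ ((0 : R), y) --> y by exact: cvg_snd.
exact: (sp _ (cPhi y _ (open_ereal_lt' yb))).
Qed.

(** The zero vector has weight [1], whose logarithm vanishes, so [extension_ge] at index [0] leaves
    [p.1 ^+ 2]. *)
Lemma extension_ge0 : A 0%N = 0 -> forall p, @closed_half R n p ->
  (0 <= extension p)%E.
Proof.
move=> A0 p p0; apply: le_trans (extension_ge 0 p0); rewrite lee_fin.
have -> : weight 0 = 1.
  rewrite /weight A0 expr0 mul1r /l1norm big1 ?expr0n/= ?oppr0 ?expR0//.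
  by move=> i _; rewrite mxE normr0.
by rewrite A0 dot0l ln1 mulr0 !add0r sqr_ge0.
Qed.

(* tau is the value at p of the extension before p.1 ^+ 2 is added; at p.1 = 0
   only the lower bound by the affine functions is needed. *)
Definition softmax_value (p : E) (tau : R) :=
  (0 < p.1 -> tau = softmax p) /\ (p.1 = 0 -> forall k, ell k p.2 <= tau).

Lemma extension_value p : 0 <= p.1 -> (extension p < +oo)%E ->
  exists2 tau, softmax_value p tau & extension p = (tau + p.1 ^+ 2)%:E.
Proof.
rewrite le_eqVlt /extension => /predU1P[p0|p0].
  rewrite -p0 eqxx expr0n/= => hy.
  have fy : Phi p.2 \is a fin_num by rewrite fin_numE pPhi.1 lt_eqF.
  exists (fine (Phi p.2)); last by rewrite addr0 fineK.
  split=> [|_ k]; first by rewrite -p0 ltxx.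
  by rewrite -lee_fin fineK// mA.
rewrite gt_eqF// => _; exists (softmax p) => //.
by split=> // p00; rewrite p00 ltxx in p0.
Qed.

(** * Joint convexity of the log-sum-exp *)

Section convex_combination.
Variables (p q : E) (t tau1 tau2 : R).
Hypotheses (p0 : 0 <= p.1) (q0 : 0 <= q.1) (t01 : 0 < t < 1).
Hypotheses (vp : softmax_value p tau1) (vq : softmax_value q tau2).

Let z : E := t *: p + (1 - t) *: q.
Let s := t * tau1 + (1 - t) * tau2.
Let e (r : E) (tau : R) k := (ell k r.2 - tau) / r.1.
(** Normalised terms of the partition sum: for [r.1 > 0] and [tau = softmax r] they add up to
    [1]. *)
Let f (r : E) (tau : R) k := weight k * expR (e r tau k).

Hypothesis z0 : 0 < z.1.

(** Exponents are quotients by the first coordinate, so they combine with weights proportional to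
    [t * p.1] and [(1 - t) * q.1], as for a perspective function. *)
Let lam1 := t * p.1 / z.1.
Let lam2 := (1 - t) * q.1 / z.1.

Let z1E : z.1 = t * p.1 + (1 - t) * q.1. Proof. by []. Qed.

Let lam1_ge0 : 0 <= lam1.
Proof. by rewrite divr_ge0 ?mulr_ge0 ?(ltW z0)//; case/andP: t01 => /ltW. Qed.

Let lam2_ge0 : 0 <= lam2.
Proof.
by rewrite divr_ge0 ?mulr_ge0 ?(ltW z0)// subr_ge0; case/andP: t01 => _ /ltW.
Qed.

Let lamD : lam1 + lam2 = 1.
Proof. by rewrite -mulrDl -z1E mulfV// gt_eqF. Qed.

Let fE r tau : f r tau =
  fun k => expR (- (tau / r.1)) * (weight k * expR (dot (A k) (persp r))).
Proof.
apply/funext => k; rewrite /f /e dot_persp mulrBl expRD; ring.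
Qed.

Let f_dominated r tau : geo_dominated (f r tau).
Proof.
by rewrite fE; apply: geo_dominatedZ; exact: psi_dominated rapid_weight.
Qed.

Let tsum_f r tau : tsum (f r tau) = expR (- (tau / r.1)) * partition_fun r.
Proof. by rewrite fE tsumZ//; exact: psi_dominated rapid_weight. Qed.

(** On the boundary the normalised sum need not be [1], but there the factor in front of it
    vanishes. *)
Let tsum_f1 (l : R) r tau : 0 <= r.1 -> softmax_value r tau ->
  l * r.1 / z.1 * tsum (f r tau) = l * r.1 / z.1.
Proof.
rewrite le_eqVlt => /predU1P[<-|r0] [vr _]; first by rewrite mulr0 !mul0r.
by rewrite tsum_f (vr r0) expR_softmax// mulr1.
Qed.

(** An equality for [r.1 > 0]; on the boundary the right side is zero and the left is nonpositive,
    because [tau] bounds all the affine functions. *)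
Let term_le (l : R) r tau k : 0 <= l -> 0 <= r.1 -> softmax_value r tau ->
  l * (ell k r.2 - tau) / z.1 <= l * r.1 / z.1 * e r tau k.
Proof.
move=> l0; rewrite le_eqVlt => /predU1P[r0|r0] [_ vr].
  rewrite -r0 mulr0 !mul0r mulr_le0_ge0 ?invr_ge0 ?(ltW z0)//.
  by rewrite mulr_ge0_le0 ?subr_le0// vr.
rewrite le_eqVlt /e; apply/orP; left; apply/eqP.
rewrite [RHS](_ : _ = (r.1 / r.1) * (l * (ell k r.2 - tau) / z.1)).
  by rewrite mulfV ?mul1r// gt_eqF.
ring.
Qed.

Let exponent_le k : e z s k <= lam1 * e p tau1 k + lam2 * e q tau2 k.
Proof.
have /andP[t0 t1] := t01.
have t1' : 0 <= 1 - t by rewrite subr_ge0 ltW.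
apply: le_trans (lerD (term_le k (ltW t0) p0 vp) (term_le k t1' q0 vq)).
rewrite -mulrDl /e /z /= homogD dotDr !dotZr /s.
by rewrite le_eqVlt; apply/orP; left; apply/eqP; congr (_ / _); ring.
Qed.

Let f_le k : f z s k <= lam1 * f p tau1 k + lam2 * f q tau2 k.
Proof.
rewrite /f !(mulrCA _ (weight k)) -mulrDr ler_wpM2l ?(ltW (weight_gt0 k))//.
apply: le_trans (expR_convex _ _ lam1_ge0 lam2_ge0 lamD).
by rewrite ler_expR exponent_le.
Qed.

Let bound_dominated :
  geo_dominated (fun k => lam1 * f p tau1 k + lam2 * f q tau2 k).
Proof. by apply: geo_dominatedD; apply: geo_dominatedZ; exact: f_dominated. Qed.

Let tsum_bound : tsum (fun k => lam1 * f p tau1 k + lam2 * f q tau2 k) = 1.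
Proof.
rewrite tsumD ?tsumZ; do ?[exact: f_dominated|
  apply: geo_dominatedZ; exact: f_dominated].
by rewrite /lam1 /lam2 !tsum_f1.
Qed.

(** By [softmax_le] it suffices that the normalised terms at [z] add up to at most [1], and [f_le]
    compares them with a series of sum [1]. *)
Lemma softmax_convex : softmax z <= s.
Proof.
by rewrite softmax_le// -tsum_f -tsum_bound; exact: ler_tsum.
Qed.

(** Equal first coordinates make [lam1 = t] and [lam2 = 1 - t], both positive, and the exponents of
    index [k] differ, so that one term is strictly smaller. *)
Lemma softmax_strictly_convex k : p.1 = q.1 ->
  ell k p.2 - ell k q.2 != tau1 - tau2 -> softmax z < s.
Proof.
move=> pq neq; rewrite softmax_lt// -tsum_f -tsum_bound.
apply: (@ltr_tsum _ _ _ k) => //.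
have /andP[t0 t1] := t01.
have zq : z.1 = q.1 by rewrite z1E pq -mulrDl addrC subrK mul1r.
rewrite /f !(mulrCA _ (weight k)) -mulrDr ltr_pM2l ?weight_gt0//.
apply: le_lt_trans (expR_convex_lt _ _ lamD _).
- by rewrite ler_expR exponent_le.
- by rewrite /lam1 pq -zq mulfK ?gt_eqF.
- by rewrite /lam2 -zq mulfK ?gt_eqF// subr_gt0.
apply: contraNneq neq; rewrite /e pq.
move/(mulIf (invr_neq0 (_ : q.1 != 0))); rewrite -zq gt_eqF// => /(_ isT) h.
by apply/eqP; lra.
Qed.

End convex_combination.

Lemma extension_convex : econvex_on (@closed_half R n) extension.
Proof.
move=> p q t p0 q0 t01; have /andP[t0 t1] := t01.
have t1' : 0 < 1 - t by rewrite subr_gt0.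
have [->|] := eqVneq (extension p) +oo%E.
  rewrite gt0_muley ?lte_fin// addye ?leey//.
  have := extensionNy q0; case: (extension q) => [s _|_|//].
    by rewrite -EFinM.
  by rewrite gt0_muley ?lte_fin.
rewrite -ltey => /(extension_value p0)[tau1 vp ep].
have [->|] := eqVneq (extension q) +oo%E.
  by rewrite gt0_muley ?lte_fin// ep -EFinM addey ?leey.
rewrite -ltey => /(extension_value q0)[tau2 vq eq].
have : 0 <= (t *: p + (1 - t) *: q).1.
  by rewrite /= addr_ge0// mulr_ge0 ?(ltW t0) ?(ltW t1').
(* If the combination lies on the boundary, so do both endpoints, and the claim is convexity of
   [Phi]. *)
rewrite le_eqVlt => /predU1P[z0|z0].
  have tp : 0 <= t * p.1 by rewrite mulr_ge0 ?(ltW t0).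
  have tq : 0 <= (1 - t) * q.1 by rewrite mulr_ge0 ?(ltW t1').
  have tpq : t * p.1 + (1 - t) * q.1 = 0 := esym z0.
  have pE : p.1 = 0 by apply: (mulfI (lt0r_neq0 t0)); lra.
  have qE : q.1 = 0 by apply: (mulfI (lt0r_neq0 t1')); lra.
  by rewrite /extension -z0 pE qE !eqxx; exact: cvxPhi.
rewrite ep eq -!EFinM -EFinD {1}/extension gt_eqF// lee_fin.
have := softmax_convex p0 q0 t01 vp vq z0.
have : (t *: p + (1 - t) *: q).1 ^+ 2 <= t * p.1 ^+ 2 + (1 - t) * q.1 ^+ 2.
  rewrite -subr_ge0 /= -[t *: p.1]/(t * p.1) -[(1-t) *: _]/(_ * _).
  have -> : t * p.1 ^+ 2 + (1 - t) * q.1 ^+ 2 - (t * p.1 + (1 - t) * q.1) ^+ 2 =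
    t * (1 - t) * (p.1 - q.1) ^+ 2 by ring.
  by rewrite mulr_ge0 ?sqr_ge0// mulr_ge0 ?ltW.
move: (softmax _) ((t *: p + (1 - t) *: q).1) => u v h1 h2.
by rewrite !mulrDr addrACA lerD.
Qed.

(* If every l_k increased by c along d, then so would Phi, and Phi would be
   affine along the line through y with direction d. *)
Lemma separating_index y1 y2 (c : R) : strictly_econvex_on (edom Phi) Phi ->
  y1 != y2 -> exists k, ell k y1 - ell k y2 != c.
Proof.
move=> sPhi y12; apply/not_existsP => no.
have {}no k : ell k y1 - ell k y2 = c by apply/eqP/negP => /negP; exact: no.
(* The line is taken through a point where [Phi] is finite; [y1] and [y2] need not be such
   points. *)
have [nNy [y yy]] := pPhi.
have fy : Phi y \is a fin_num by rewrite fin_numE nNy.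
pose d := y1 - y2.
have ellD k (u : R) : ell k (y + u *: d) = ell k y + u * c.
  have -> : homog (y + u *: d) = homog y + u *: (homog y1 - homog y2).
    rewrite /homog opp_row_mx add_row_mx subrr scale_row_mx add_row_mx.
    by rewrite scaler0 addr0.
  by rewrite dotDr dotZr dotDr dotNr no.
have PhiD (u : R) : (Phi (y + u *: d) <= (fine (Phi y) + u * c)%:E)%E.
  rewrite leNgt; apply/negP => /supA[k].
  rewrite ellD ltrD2r ltNge => /negP; apply.
  by rewrite -lee_fin fineK// mA.
have domD (u : R) : edom Phi (y + u *: d).
  by apply: le_lt_trans (PhiD u) _; rewrite ltry.
have half01 : 0 < (2^-1 : R) < 1 by lra.
have neq : y + 1 *: d != y + (-1) *: d.
  rewrite -subr_eq0 opprD addrACA subrr add0r -scalerBl scaler_eq0 subr_eq0.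
  rewrite negb_or subr_eq0 y12 andbT; apply/eqP; lra.
(* [y] is the midpoint of [y + d] and [y - d], where the bounds [PhiD] average to exactly [Phi y],
   against strict convexity. *)
have := sPhi _ _ _ (domD 1) (domD (-1)) neq half01.
have -> : 2^-1 *: (y + 1 *: d) + (1 - 2^-1) *: (y + -1 *: d) = y.
  have -> : 1 - 2^-1 = 2^-1 :> R by lra.
  rewrite -scalerDr addrACA -scalerDl subrr scale0r addr0.
  rewrite -mulr2n -(scaler_nat 2 y).
  by rewrite scalerA mulVf ?scale1r.
apply/negP; rewrite -leNgt.
apply: le_trans (leeD (lee_wpmul2l _ (PhiD 1)) (lee_wpmul2l _ (PhiD (-1)))) _.
- by rewrite lee_fin; lra.
- by rewrite lee_fin; lra.
by rewrite -!EFinM -EFinD -{3}(fineK fy) lee_fin; lra.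
Qed.

Lemma extension_strictly_convex : strictly_econvex_on (edom Phi) Phi ->
  strictly_econvex_on (@open_half R n) extension.
Proof.
move=> sPhi p q t p0 q0 pq t01; have /andP[t0 t1] := t01.
have t1' : 0 < 1 - t by rewrite subr_gt0.
have z0 : 0 < (t *: p + (1 - t) *: q).1 by rewrite /= addr_gt0// mulr_gt0.
have vp : softmax_value p (softmax p).
  by split=> // p00; move: p0; rewrite /open_half /= p00 ltxx.
have vq : softmax_value q (softmax q).
  by split=> // q00; move: q0; rewrite /open_half /= q00 ltxx.
rewrite /extension !gt_eqF// -!EFinM -EFinD lte_fin.
have le1 := softmax_convex (ltW p0) (ltW q0) t01 vp vq z0.
have sq : t * p.1 ^+ 2 + (1 - t) * q.1 ^+ 2 - (t *: p + (1 - t) *: q).1 ^+ 2 =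
    t * (1 - t) * (p.1 - q.1) ^+ 2.
  rewrite /= -[t *: p.1]/(t * p.1) -[(1-t) *: _]/(_ * _); ring.
rewrite !mulrDr addrACA.
have [pq1|pq1] := eqVneq p.1 q.1; last first.
  apply: ler_ltD => //; rewrite -subr_gt0 sq pmulr_rgt0 ?(mulr_gt0 t0 t1')//.
  by rewrite exprn_even_gt0 ?subr_eq0.
apply: ltr_leD; last by rewrite -subr_ge0 sq pq1 subrr expr0n mulr0.
have pq2 : p.2 != q.2.
  by move: pq; rewrite -pair_eqE /pair_eq/= pq1 eqxx.
have [k hk] := separating_index (softmax p - softmax q) sPhi pq2.
exact: (softmax_strictly_convex (ltW p0) (ltW q0) t01 vp vq z0 pq1 hk).
Qed.

Lemma good_extension_extension : good_extension Phi extension.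
Proof.
split; first by move=> p; exact: extensionNy.
split.
- exact: lsc_extension.
- exact: extension_convex.
- by move=> y; rewrite /extension eqxx.
- exact: extension_limit.
- by split; [exact: open_half_fin|exact: smooth_extension].
Qed.

End extension.

Unset Implicit Arguments.
Set Strict Implicit.

Theorem theorem1 (R : realType) (n : nat) (Phi : 'rV[R]_n -> \bar R) :
  proper_fun Phi -> lower_semicontinuous Phi -> econvex_on setT Phi ->
  [/\ (exists phi, good_extension Phi phi),
      ((forall y, (0 <= Phi y)%E) ->
        exists phi, good_extension Phi phi /\
          (forall p, @closed_half R n p -> (0 <= phi p)%E)),
      (continuous Phi ->
        exists phi, good_extension Phi phi /\
          {within @closed_half R n, continuous phi})
    & (strictly_econvex_on (edom Phi) Phi ->
        exists phi, good_extension Phi phi /\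
          strictly_econvex_on (@open_half R n) phi)].
Proof.
move=> pPhi lscPhi cvxPhi.
have [A0 mA0] := minorant_exists pPhi lscPhi cvxPhi.
have [A [_ mA supA]] := countable_minorants pPhi lscPhi cvxPhi mA0.
have good := good_extension_extension pPhi cvxPhi mA supA.
split.
- by eexists; exact: good.
(* For nonnegative [Phi] the zero function is an affine minorant and can head the family. *)
- move=> Phi0; have m0 : minorant Phi 0 by move=> y; rewrite dot0l.
  have [B [B0 mB supB]] := countable_minorants pPhi lscPhi cvxPhi m0.
  exists (extension Phi B); split; last exact: extension_ge0.
  exact: good_extension_extension.
- move=> cPhi; exists (extension Phi A); split => //.
  exact: extension_continuous.
- move=> sPhi; exists (extension Phi A); split => //.
  exact: extension_strictly_convex.
Qed.
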